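(* Let $\mathsf V$ be a finite dimensional real vector space with basis $\{\mathsf e_i\}_{i=1}^{\dim \mathsf V}$ and two inner products $(\cdot,\cdot)_M$, $(\cdot,\cdot)_A$ represented by the symmetric positive definite matrices $M$ and $A$. Let $p\ge 0$ be an integer, let $\tau>0$, let $\mathcal F\colon\mathcal V_p\to\mathbb R$ be a linear functional, and let $\mathcal B$, $\mathcal I$, $P$ be as defined in the context. Define the bilinear form $\mathcal L\colon \mathcal V_p\times\mathcal V_p\to\mathbb R$ and the linear functional $\mathcal G\colon\mathcal V_p\to\mathbb R$ by $$\mathcal L(u,v):=\mathcal B(u,Pv),\qquad \mathcal G(v):=\mathcal F(Pv)\qquad \forall\,u,v\in\mathcal V_p.$$ Then for all $u,v\in\mathcal V_p$, $$\mathcal L(u,v)=\int_{-1}^1\big((\mathcal I u)',(\mathcal I v)'\big)_{MA^{-1}M}\,\mathrm ds+\frac{\tau^2}{4}\int_{-1}^1(u,v)_A\,\mathrm ds+\frac{\tau}{2}\,(u(1),v(1))_M+\frac{\tau}{2}\,(u(-1),v(-1))_M .$$ Therefore $\mathcal L$ is symmetric and positive definite on $\mathcal V_p$, and $$\mathcal L(v,v)\ge\|v\|_{\mathcal D}^2,\qquad |\mathcal L(v,w)|\le 2\,\|v\|_{\mathcal D}\,\|w\|_{\mathcal D}\qquad\forall\,v,w\in\mathcal V_p,$$ where $\|v\|_{\mathcal D}:=\sqrt{\mathcal D(v,v)}$ is the norm induced by the bilinear form $$\mathcal D(u,v):=\int_{-1}^1\big((\mathcal I u)',(\mathcal I v)'\big)_{MA^{-1}M}\,\mathrm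 ds+\frac{\tau^2}{4}\int_{-1}^1(u,v)_A\,\mathrm ds .$$ Moreover, a function $u\in\mathcal V_p$ satisfies $\mathcal B(u,v)=\mathcal F(v)$ for all $v\in\mathcal V_p$ if and only if it satisfies $\mathcal L(u,v)=\mathcal G(v)$ for all $v\in\mathcal V_p$.
   Context: The matrices are $M_{ij}=(\mathsf e_i,\mathsf e_j)_M$, $A_{ij}=(\mathsf e_i,\mathsf e_j)_A$; elements of $\mathsf V$ are identified with their coordinate vectors in the basis $\{\mathsf e_i\}$, so that matrices such as $A^{-1}M$ act on $\mathsf V$. The inner product $(\cdot,\cdot)_{MA^{-1}M}$ on $\mathsf V$ is $(\mathsf v,\mathsf w)_{MA^{-1}M}=\mathsf w^\top MA^{-1}M\mathsf v$. $\mathcal P_p$ is the space of real polynomials in one real variable of degree at most $p$, and $\mathcal V_p$ is the space of $\mathsf V$-valued polynomials of one real variable of degree at most $p$, i.e. functions $v(s)=\sum_{j=0}^p\mathsf v_j\phi_j(s)$ with $\mathsf v_j\in\mathsf V$ and $\{\phi_j\}_{j=0}^p$ a basis of $\mathcal P_p$. Linear operators on $\mathsf V$ act on $\mathcal V_p$ coefficient-wise ($Lv=\sum_j (L\mathsf v_j)\phi_j$), and linear operators $\pi$ on $\mathcal P_p$ act on $\mathcal V_p$ by $\pi v=\sum_j\mathsf v_j\,(\pi\phi_j)$; in particular $v'=\sum_j\mathsf v_j\phi_j'$. $L_k$ denotes the Legendre polynomial of degree $k$ on $(-1,1)$, normalized so that $L_k(1)=1$. The reconstruction operator $\mathcal I\colon\mathcal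 P_p\to\mathcal P_{p+1}$ is $$\mathcal I v:=v-v(-1)\,\frac{(-1)^p(L_p-L_{p+1})}{2},$$ extended to $\mathcal I\colon\mathcal V_p\to\mathcal V_{p+1}$ by $\mathcal I v:=\sum_{j=0}^p\mathsf v_j\,(\mathcal I\phi_j)$ for $v=\sum_{j=0}^p\mathsf v_j\phi_j\in\mathcal V_p$ (so $(\mathcal I v)'\in\mathcal V_p$ for $v\in\mathcal V_p$). The bilinear form $\mathcal B\colon\mathcal V_p\times\mathcal V_p\to\mathbb R$ is $$\mathcal B(u,v):=\int_{-1}^1(u',v)_M\,\mathrm ds+(u(-1),v(-1))_M+\frac{\tau}{2}\int_{-1}^1(u,v)_A\,\mathrm ds,$$ and the operator $P\colon\mathcal V_p\to\mathcal V_p$ is $Pv:=A^{-1}M(\mathcal I v)'+\frac{\tau}{2}v$. *)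

(* Defs.v *)
From HB Require Import structures.
From mathcomp Require Import all_boot all_order all_algebra.
From mathcomp Require Import all_classical all_reals all_analysis.

Set Implicit Arguments.
Unset Strict Implicit.
Unset Printing Implicit Defensive.

Import Order.TTheory GRing.Theory Num.Theory.

Local Open Scope ring_scope.

(* The Legendre polynomial of degree k, by the formula of Rodrigues. *)
Definition legendre (R : realType) (k : nat) : {poly R} :=
  ((2 ^+ k * k`!%:R)^-1) *: (('X^2 - 1) ^+ k)^`(k).

Definition reconstruct (R : realType) (p : nat) (f : {poly R}) : {poly R} :=
  f - (f.[-1] * ((-1) ^+ p / 2)) *: (legendre R p - legendre R p.+1).

(* A V-valued polynomial of degree at most p is given by its coefficients in
   the monomial basis. This determines it as a function (vpoly_eval_inj), and
   the operations below do not depend on the choice of the monomials as basis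
   of the scalar polynomials of degree at most p (vpoly_act_sum). *)
Notation vpoly V p := {ffun 'I_p.+1 -> V}.

Section VectorPolynomials.
Context {R : realType} {V : vectType R}.

Definition vpoly_eval (p : nat) (v : vpoly V p) (s : R) : V :=
  \sum_(j < p.+1) s ^+ j *: v j.

(* The V-valued polynomial s |-> f(s) x, for f of degree at most p (see
   vpoly_tensorE); coefficients of f of higher degree are dropped. *)
Definition vpoly_tensor (p : nat) (x : V) (f : {poly R}) : vpoly V p :=
  [ffun j : 'I_p.+1 => f`_j *: x].

(* The action on V-valued polynomials of an operator pi from the scalar
   polynomials of degree at most p to those of degree at most q. *)
Definition vpoly_act (p q : nat) (pi : {poly R} -> {poly R})
    (v : vpoly V p) : vpoly V q :=
  \sum_(j < p.+1) vpoly_tensor q (v j) (pi 'X^j).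

Definition vpoly_map (p : nat) (T : V -> V) (v : vpoly V p) : vpoly V p :=
  [ffun j : 'I_p.+1 => T (v j)].

Definition vpoly_deriv (p : nat) (v : vpoly V p) : vpoly V p :=
  vpoly_act p (@deriv R) v.

Definition vpoly_reconstruct (p : nat) (v : vpoly V p) : vpoly V p.+1 :=
  vpoly_act p.+1 (reconstruct p) v.

Definition vpoly_deriv_reconstruct (p : nat) (v : vpoly V p) : vpoly V p :=
  vpoly_act p (@deriv R) (vpoly_reconstruct v).

End VectorPolynomials.

Section Coordinates.
Context {R : realType} {V : vectType R} {n : nat}.
Implicit Types (e : n.-tuple V) (N : 'M[R]_n).

Definition coord_col e (v : V) : 'cV[R]_n := \col_i coord e i v.

Definition gram_mx e (f : V -> V -> R) : 'M[R]_n := \matrix_(i, j) f e`_i e`_j.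

Definition mx_act e N (v : V) : V := \sum_(i < n) (N *m coord_col e v) i 0 *: e`_i.

Definition mx_form e N (v w : V) : R :=
  ((coord_col e w)^T *m N *m coord_col e v) 0 0.

End Coordinates.

Section Forms.
Context {R : realType} {V : vectType R} {n : nat}.
Variables (e : n.-tuple V) (ipM ipA : V -> V -> R) (p : nat) (tau : R).
Implicit Types u v : vpoly V p.

Let M : 'M[R]_n := gram_mx e ipM.
Let A : 'M[R]_n := gram_mx e ipA.

Definition int_form (q : nat) (f : V -> V -> R) (u v : vpoly V q) : R :=
  \int[lebesgue_measure]_(s in `[-1, 1]%classic)
     f (vpoly_eval u s) (vpoly_eval v s).

Definition B_form u v : R :=
  int_form ipM (vpoly_deriv u) v
  + ipM (vpoly_eval u (-1)) (vpoly_eval v (-1))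
  + tau / 2 * int_form ipA u v.

Definition P_op v : vpoly V p :=
  vpoly_map (mx_act e (invmx A *m M)) (vpoly_deriv_reconstruct v)
  + (tau / 2) *: v.

Definition D_form u v : R :=
  int_form (mx_form e (M *m invmx A *m M))
    (vpoly_deriv_reconstruct u) (vpoly_deriv_reconstruct v)
  + tau ^+ 2 / 4 * int_form ipA u v.

End Forms.

(* What {dot U for idfun} bundles, as a property of a bare function. *)
Definition spd_form (R : realType) (U : lmodType R) (f : U -> U -> R) : Prop :=
  [/\ bilinear_for *%R *%R f,
      forall x y, f x y = f y x &
      forall x, x != 0 -> 0 < f x x].

Lemma dot_spd_form (R : realType) (U : lmodType R) (f : {dot U for idfun}) :
  spd_form f.
Proof.
split=> [|x y|x].
- split=> [u'|u] a x y /=; first by rewrite linearPl.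
  by rewrite linearPr.
- by rewrite (@hermitian_subproof _ _ _ _ f x y) expr0 mul1r.
- exact: neq0_dnorm_gt0.
Qed.

Section Facts.
Context {R : realType} {V : vectType R}.

Lemma legendre_at1 (k : nat) : (legendre R k).[1] = 1.
Proof.
have H (q : {poly R}) : ((('X - 1%:P) ^+ k * q)^`(k)).[1] = k`!%:R * q.[1].
  elim: k q => [|k IH] q; first by rewrite expr0 mul1r fact0 mul1r.
  rewrite derivSn derivM deriv_exp derivXsubC mul1r /=.
  rewrite (_ : _ + _ = ('X - 1%:P) ^+ k * (q *+ k.+1 + ('X - 1%:P) * q^`())).
    rewrite IH !hornerE subrr mul0r addr0 hornerMn factS natrM.
    by rewrite -[q.[1] *+ _]mulr_natl mulrA [_ * k`!%:R]mulrC.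
  by rewrite mulrDr mulrA -exprSr mulrnAl mulrnAr.
rewrite /legendre hornerZ.
have -> : ('X^2 - 1) ^+ k = ('X - 1%:P) ^+ k * ('X + 1%:P) ^+ k :> {poly R}.
  by rewrite -exprMn -subr_sqr polyC1 expr1n.
rewrite H horner_exp hornerD hornerX hornerC [k`!%:R * _]mulrC mulVf //.
Qed.

Lemma size_legendre (k : nat) : (size (legendre R k) <= k.+1)%N.
Proof.
apply: leq_trans (size_scale_leq _ _) _.
have sz_derivn (f : {poly R}) m : (size f^`(m) <= size f - m)%N.
  apply/leq_sizeP => j hj; rewrite coef_derivn nth_default ?mul0rn //.
  by rewrite -leq_subLR.
apply: leq_trans (sz_derivn _ _) _.
rewrite leq_subLR; apply: leq_trans (size_poly_exp_leq _ _) _.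
rewrite (_ : size _ = 3)%N; first by rewrite mul2n -addnn addnS.
by rewrite -[1]polyC1 size_XnsubC.
Qed.

Lemma size_reconstruct (p : nat) (f : {poly R}) :
  (size f <= p.+1)%N -> (size (reconstruct p f) <= p.+2)%N.
Proof.
move=> sf; apply: leq_trans (size_polyD _ _) _.
rewrite geq_max (leq_trans sf) // size_polyN.
apply: leq_trans (size_scale_leq _ _) _.
apply: leq_trans (size_polyD _ _) _.
by rewrite geq_max size_polyN (leq_trans (size_legendre _)) //= size_legendre.
Qed.

Lemma vpoly_tensorE (p : nat) (x : V) (f : {poly R}) (s : R) :
  (size f <= p.+1)%N -> vpoly_eval (vpoly_tensor p x f) s = f.[s] *: x.
Proof.
move=> sf; rewrite (horner_coef_wide _ sf) scaler_suml.
by apply: eq_bigr => j _; rewrite ffunE scalerA mulrC.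
Qed.

Lemma vpoly_eval_inj (p : nat) (u v : vpoly V p) :
  vpoly_eval u =1 vpoly_eval v -> u = v.
Proof.
move=> uv; apply/ffunP => j; apply/eqP; rewrite -subr_eq0; apply/eqP.
rewrite (coord_vbasis (memvf (u j - v j))) big1 // => i _.
pose c k := coord (vbasis {: V}) i (u k - v k).
pose f : {poly R} := \poly_(k < p.+1) c (inord k).
suff f0 : f = 0.
  have := congr1 (fun g : {poly R} => g`_j) f0.
  by rewrite coef_poly ltn_ord inord_val coef0 /c => ->; rewrite scale0r.
have f_eval s : f.[s] = 0.
  rewrite horner_poly.
  transitivity (coord (vbasis {: V}) i (vpoly_eval u s - vpoly_eval v s)).
    rewrite /vpoly_eval -sumrB linear_sum /=; apply: eq_bigr => k _.
    by rewrite -scalerBr linearZ /= mulrC inord_val.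
  by rewrite uv subrr linear0.
apply/eqP/negP => /negP f_neq0.
pose rs : seq R := [seq k%:R | k <- iota 0 (size f)].
have := @max_poly_roots _ f rs f_neq0.
rewrite size_map size_iota ltnn => H; suff: false by [].
apply: H; first by apply/allP => x _; rewrite /root f_eval.
by rewrite map_inj_uniq ?iota_uniq // => a b /eqP; rewrite eqr_nat => /eqP.
Qed.

Lemma reconstruct_is_linear (p : nat) : linear (@reconstruct R p).
Proof.
move=> a f g; rewrite /reconstruct hornerD hornerZ.
move: (legendre R p - _) (_ / 2) => d c.
by rewrite mulrDl scalerDl opprD addrACA scalerBr scalerA mulrA.
Qed.

HB.instance Definition _ (p : nat) :=
  GRing.isLinear.Build R {poly R} {poly R} *:%R (@reconstruct R p)
    (@reconstruct_is_linear p).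

Lemma vpoly_act_sum (p q m : nat) (pi : {linear {poly R} -> {poly R}})
    (phi : 'I_m -> {poly R}) (x : 'I_m -> V) :
  (forall j, (size (phi j) <= p.+1)%N) ->
  vpoly_act q pi (\sum_(j < m) vpoly_tensor p (x j) (phi j))
    = \sum_(j < m) vpoly_tensor q (x j) (pi (phi j)).
Proof.
move=> sphi; apply/ffunP => k; rewrite /vpoly_act !sum_ffunE.
under eq_bigr => i _ do rewrite ffunE sum_ffunE scaler_sumr.
rewrite exchange_big /=; apply: eq_bigr => j _; rewrite ffunE.
have -> : phi j = \sum_(i < p.+1) (phi j)`_i *: 'X^i.
  rewrite -poly_def; apply/polyP => i; rewrite coef_poly; case: ltnP => // hi.
  by rewrite nth_default // (leq_trans (sphi j)).
rewrite linear_sum coef_sum scaler_suml; apply: eq_bigr => i _.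
rewrite linearZ coefZ ffunE -poly_def coef_poly ltn_ord.
by rewrite !scalerA mulrC.
Qed.

End Facts.

(* Main.v *)
(* With Q u := A^-1 M (I u)', and J u v the integral of (u, v)_A, orthogonality
   of the Legendre polynomials gives B(u, w) = J (Q u + tau/2 u) w = J (P u) w.
   Hence L(u, v) = J (P u) (P v), and expanding yields D(u, v) plus the cross
   term tau/2 (J (Q u) v + J u (Q v)), which integration by parts turns into
   the boundary terms. Coercivity is their nonnegativity; boundedness is
   Cauchy-Schwarz for L together with J (Q v - tau/2 v) (Q v - tau/2 v) >= 0.
   As L is definite, P is injective, hence surjective by finite dimension, and
   testing with P v is as good as testing with v. *)

Require Import Defs.
From HB Require Import structures.
From mathcomp Require Import all_boot all_order all_algebra.
From mathcomp Require Import all_classical all_reals all_analysis.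
From mathcomp Require Import ring lra.

Set Implicit Arguments.
Unset Strict Implicit.
Unset Printing Implicit Defensive.

Import Order.TTheory GRing.Theory Num.Theory.
Import numFieldNormedType.Exports.

Local Open Scope ring_scope.

(** * Integration of real polynomials over [[-1, 1]] *)

Section PolynomialIntegral.
Context {R : realType}.
Implicit Types f g h : {poly R}.

Definition poly_int f : R :=
  \int[lebesgue_measure]_(s in `[-1, 1]%classic) f.[s].

Lemma poly_int_deriv f : poly_int f^`() = f.[1] - f.[-1].
Proof.
have cont (q : {poly R}) A : {within A, continuous (horner q)}%classic.
  exact/continuous_subspaceT/continuous_horner.
rewrite /poly_int /Rintegral (@continuous_FTC2 _ _ (horner f)) //.
- split=> [x _||]; first exact: derivable_horner.
    exact/cvg_at_right_filter/continuous_horner.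
  exact/cvg_at_left_filter/continuous_horner.
- by move=> x _; rewrite derivE.
Qed.

(** Linearity and positivity of [poly_int] thereby reduce to endpoint values of antiderivatives. *)
Lemma deriv_surj f : exists g, g^`() = f.
Proof.
(* At [i = 0] the division by [0] yields [0], so this antiderivative has constant term zero. *)
exists (\poly_(i < (size f).+1) (f`_i.-1 / i%:R)).
apply/polyP => i; rewrite coef_deriv coef_poly ltnS /=; case: ltnP => hi.
  by rewrite -[LHS]mulr_natr divfK ?pnatr_eq0.
by rewrite mul0rn nth_default.
Qed.

Lemma size_deriv_leq (n : nat) f : (size f <= n.+1)%N -> (size f^`() <= n)%N.
Proof.
case: (eqVneq f 0) => [->|f0]; first by rewrite deriv0 size_poly0.
by move=> sf; rewrite -ltnS (leq_trans (lt_size_deriv f0)).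
Qed.

Fact poly_int_is_scalar : scalar poly_int.
Proof.
move=> a f g; have [F <-] := deriv_surj f; have [G <-] := deriv_surj g.
rewrite -derivZ -derivD !poly_int_deriv !hornerD !hornerZ. ring.
Qed.

HB.instance Definition _ :=
  GRing.isLinear.Build R {poly R} R *%R poly_int poly_int_is_scalar.

Lemma poly_int_by_parts f g :
  poly_int (f^`() * g) = f.[1] * g.[1] - f.[-1] * g.[-1] - poly_int (f * g^`()).
Proof.
by rewrite -!hornerM -poly_int_deriv derivM linearD addrK.
Qed.

(** An antiderivative [F] of a nonnegative [f] is nondecreasing on [[-1, 1]]. If the integral is not
    positive, the endpoint values pinch [F] to a constant, whence [f = 0]. *)
Lemma poly_int_gt0 f :
  (forall s, 0 <= f.[s]) -> f != 0 -> 0 < poly_int f.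
Proof.
have [F <-{f}] := deriv_surj f => f_ge0.
apply: contraNT; rewrite poly_int_deriv -leNgt subr_le0 => F1.
have incF x y : -1 <= x -> x <= y -> y <= 1 -> F.[x] <= F.[y].
  apply: (@ger0_derive1_ndecr R (horner F) (-1) 1).
  - by move=> z _; exact: derivable_horner.
  - by move=> z _; rewrite -derivE.
  - exact/continuous_subspaceT/continuous_horner.
suff -> : F = (F.[-1])%:P; first by rewrite derivC.
apply/eqP; rewrite -subr_eq0; apply/negP => /negP F0.
(* The points [1 / (k + 1)] lie in the interval and are one more in number than the degree of
   [F - F(-1)]: too many roots. *)
pose rs : seq R := [seq k.+1%:R^-1 | k <- iota 0 (size (F - F.[-1]%:P))].
have := @max_poly_roots _ _ rs F0.
rewrite size_map size_iota ltnn => H; suff: false by [].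
apply: H; last first.
  rewrite map_inj_uniq ?iota_uniq // => a b /invr_inj /eqP.
  by rewrite eqr_nat => /eqP [].
apply/allP => x /mapP[k _ ->]; rewrite /root !hornerE subr_eq0 eq_le.
have x0 : -1 <= k.+1%:R^-1 :> R by apply: (le_trans (lerN10 _)).
have x1 : k.+1%:R^-1 <= 1 :> R by rewrite invf_le1 ?ler1n.
by rewrite (le_trans _ F1) ?incF.
Qed.

End PolynomialIntegral.

(** * Endpoint values and orthogonality of the Legendre polynomials *)

Section Legendre.
Context {R : realType}.
Implicit Types f g q : {poly R}.

(** Each derivative lowers the multiplicity of the root [a] by at most one. *)
Lemma derivn_XsubC_exp_mul (a : R) (k m : nat) q :
  exists r, ((('X - a%:P) ^+ (k + m) * q)^`(k)) = ('X - a%:P) ^+ m * r.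
Proof.
elim: k m q => [|k IH] m q; first by exists q.
rewrite derivnS addSnnS; have [r ->] := IH m.+1 q.
exists (r *+ m.+1 + ('X - a%:P) * r^`()).
rewrite derivM deriv_exp derivXsubC mul1r /= exprSr [RHS]mulrDr mulrA.
by rewrite mulrnAl mulrnAr.
Qed.

(** In the Leibniz expansion only the term with all [k] derivatives on the power survives at [a]. *)
Lemma horner_derivn_XsubC_exp_mul (a : R) (k : nat) q :
  ((('X - a%:P) ^+ k * q)^`(k)).[a] = k`!%:R * q.[a].
Proof.
elim: k q => [|k IH] q; first by rewrite expr0 mul1r fact0 mul1r.
rewrite derivSn derivM deriv_exp derivXsubC mul1r /=.
rewrite (_ : _ + _ = ('X - a%:P) ^+ k * (q *+ k.+1 + ('X - a%:P) * q^`())).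
  rewrite IH !hornerE subrr mul0r addr0 hornerMn factS natrM.
  by rewrite -[q.[a] *+ _]mulr_natl mulrA [_ * k`!%:R]mulrC.
by rewrite mulrDr mulrA -exprSr mulrnAl mulrnAr.
Qed.

Lemma sqrX_sub1_exp (k : nat) :
  ('X^2 - 1) ^+ k = ('X - 1%:P) ^+ k * ('X - (-1)%:P) ^+ k :> {poly R}.
Proof. by rewrite -exprMn polyCN opprK -subr_sqr polyC1 expr1n. Qed.

Lemma legendre_atN1 (k : nat) : (legendre R k).[-1] = (-1) ^+ k.
Proof.
rewrite /legendre hornerZ sqrX_sub1_exp mulrC [_ ^+ k * _]mulrC.
rewrite horner_derivn_XsubC_exp_mul horner_exp !hornerE.
rewrite (_ : -1 - 1 = (-1) * 2 :> R) ?exprMn; last by ring.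
have k_neq0 : k`!%:R != 0 :> R by rewrite pnatr_eq0 -lt0n fact_gt0.
have exp2_neq0 : 2 ^+ k != 0 :> R by rewrite expf_neq0 ?pnatr_eq0.
by rewrite mulrCA -mulrA [k`!%:R * _]mulrC divff ?mulr1 ?mulf_neq0.
Qed.

(** Both endpoints are treated at once: [a ^+ 2 = 1] gives [X^2 - 1 = (X - a) (X + a)], so [a] is a
    root of multiplicity at least [k]. *)
Lemma derivn_sqrX_sub1_exp_at (k j : nat) (a : R) : (j < k)%N -> a ^+ 2 = 1 ->
  ((('X^2 - 1) ^+ k)^`(j)).[a] = 0.
Proof.
move=> jk a2; have [m km] : exists m, k = (j + m.+1)%N.
  by exists (k - j).-1; rewrite prednK ?subn_gt0 // subnKC // ltnW.
have -> : ('X^2 - 1) ^+ k = ('X - a%:P) ^+ k * ('X + a%:P) ^+ k :> {poly R}.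
  by rewrite -exprMn -subr_sqr -polyC_exp a2.
rewrite {1}km; have [r ->] := derivn_XsubC_exp_mul a j m.+1 (('X + a%:P) ^+ k).
by rewrite hornerM horner_exp !hornerE subrr expr0n mul0r.
Qed.

(** Repeated integration by parts in the formula of Rodrigues moves the derivatives onto [g]; all
    boundary terms vanish. *)
Lemma legendre_orthogonal (k : nat) g :
  (size g <= k)%N -> poly_int (legendre R k * g) = 0.
Proof.
move=> sg; rewrite /legendre -scalerAl linearZ /=.
(* The size bound on [h] falls with the number [j] of derivatives left, while the power [k] stays
   fixed; at [j = 0] this forces [h = 0]. *)
suff H j (h : {poly R}) : (j <= k)%N -> (size h <= j)%N ->
    poly_int ((('X^2 - 1) ^+ k)^`(j) * h) = 0.
  by rewrite H ?mulr0.
elim: j h => [|j IH] h jk sh.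
  by move: sh; rewrite leqn0 size_poly_eq0 => /eqP ->; rewrite mulr0 linear0.
rewrite derivnS poly_int_by_parts !derivn_sqrX_sub1_exp_at ?sqrrN ?expr1n //.
rewrite !mul0r IH ?subrr ?(ltnW jk) //.
exact: size_deriv_leq.
Qed.

(* The reconstruction vanishes at -1 and only adds Legendre polynomials of
   degree at least p, which are orthogonal to g^`(). *)
Lemma poly_int_deriv_reconstruct (p : nat) f g : (size g <= p.+1)%N ->
  poly_int ((reconstruct p f)^`() * g)
  = poly_int (f^`() * g) + f.[-1] * g.[-1].
Proof.
move=> sg; have sg' := size_deriv_leq sg.
rewrite /reconstruct derivB derivZ mulrBl linearB -scalerAl linearZ /=.
rewrite (poly_int_by_parts (_ - _)) mulrBl linearB /=.
rewrite !legendre_orthogonal ?(leqW sg') // !hornerD !hornerN.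
rewrite !legendre_at1 !legendre_atN1 exprS.
have : (-1) ^+ p * (-1) ^+ p = 1 :> R by rewrite -expr2 sqrr_sign.
move: ((-1) ^+ p) => c c2.
(* [L_p - L_(p+1)] vanishes at [1] and equals [2 c] at [-1]; the factor [c / 2] of the
   reconstruction turns this into [c * c = 1]. *)
transitivity (poly_int (f^`() * g) + (c * c) * (f.[-1] * g.[-1])); last first.
  by rewrite c2 mul1r.
by field.
Qed.

(** Integration by parts alone gives the term at [-1] with a minus sign; the two reconstructions add
    it twice, which makes the sign positive. *)
Lemma poly_int_deriv_reconstruct_sym (p : nat) f g :
  (size f <= p.+1)%N -> (size g <= p.+1)%N ->
  poly_int ((reconstruct p f)^`() * g) + poly_int ((reconstruct p g)^`() * f)
  = f.[1] * g.[1] + f.[-1] * g.[-1].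
Proof.
move=> sf sg; rewrite !poly_int_deriv_reconstruct // poly_int_by_parts.
rewrite [g^`() * f]mulrC; ring.
Qed.

End Legendre.

(** * Algebra of symmetric positive definite forms *)

Section SpdForm.
Context {R : realType} {U : lmodType R} {f : U -> U -> R}.
Hypothesis f_spd : spd_form f.
Implicit Types (x y z : U) (a : R).

Lemma spdC x y : f x y = f y x.
Proof. by case: f_spd. Qed.

Lemma spd_gt0 x : x != 0 -> 0 < f x x.
Proof. by case: f_spd => _ _; apply. Qed.

Lemma spdPl a x y z : f (a *: x + y) z = a * f x z + f y z.
Proof. by case: f_spd => -[fl _] _ _; exact: fl. Qed.

Lemma spdPr a x y z : f z (a *: x + y) = a * f z x + f z y.
Proof. by rewrite spdC spdPl !(spdC z). Qed.

Lemma spdDl x y z : f (x + y) z = f x z + f y z.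
Proof. by rewrite -[x]scale1r spdPl mul1r scale1r. Qed.

Lemma spdDr x y z : f z (x + y) = f z x + f z y.
Proof. by rewrite spdC spdDl !(spdC z). Qed.

Lemma spd0l z : f 0 z = 0.
Proof. by apply: (addrI (f 0 z)); rewrite -spdDl !addr0. Qed.

Lemma spd0r z : f z 0 = 0.
Proof. by rewrite spdC spd0l. Qed.

Lemma spdZl a x z : f (a *: x) z = a * f x z.
Proof. by rewrite -[a *: x]addr0 spdPl spd0l addr0. Qed.

Lemma spdZr a x z : f z (a *: x) = a * f z x.
Proof. by rewrite spdC spdZl spdC. Qed.

Lemma spd_ge0 x : 0 <= f x x.
Proof. by case: (eqVneq x 0) => [->|/spd_gt0/ltW//]; rewrite spd0l. Qed.

Lemma spd_eq0 x : f x x = 0 -> x = 0.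
Proof. by case: (eqVneq x 0) => // /spd_gt0 /[swap] ->; rewrite ltxx. Qed.

Lemma spd_suml_sumr (m n : nat) (a : 'I_m -> R) (b : 'I_n -> R)
    (x : 'I_m -> U) (y : 'I_n -> U) :
  f (\sum_(i < m) a i *: x i) (\sum_(j < n) b j *: y j)
  = \sum_(i < m) \sum_(j < n) f (x i) (y j) * (a i * b j).
Proof.
rewrite (big_morph (f^~ _) (fun u v => spdDl u v _) (spd0l _)).
apply: eq_bigr => i _.
rewrite (big_morph (f _) (fun u v => spdDr u v _) (spd0r _)).
by apply: eq_bigr => j _; rewrite spdZl spdZr; ring.
Qed.

Lemma spd_CauchySchwarz x y : f x y ^+ 2 <= f x x * f y y.
Proof.
case: (eqVneq y 0) => [->|y0]; first by rewrite !spd0r expr0n mulr0.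
(* This vector is [f y y] times the component of [x] orthogonal to [y], which avoids a division. *)
have := spd_ge0 (f y y *: x + (- f x y) *: y).
rewrite spdPl !spdDr !spdZl !spdZr [f y x]spdC.
rewrite (_ : _ + _ = f y y * (f x x * f y y - f x y ^+ 2)); last by ring.
by rewrite pmulr_rge0 ?spd_gt0 // subr_ge0.
Qed.

End SpdForm.

(** * Abstract symmetrization by an operator with nonnegative symmetric part *)

Section Symmetrization.
Context {R : realType} {U : lmodType R} (J b : U -> U -> R).
Variables (Q : U -> U) (t : R).
Hypotheses (J_spd : spd_form J) (Q_lin : linear Q) (t_gt0 : 0 < t).
Hypothesis QJ : forall u v, J (Q u) v + J u (Q v) = b u v.
Hypothesis b_ge0 : forall v, 0 <= b v v.

(** In the application [t] is [tau / 2], [J] integrates the A-product and [b] adds the M-products at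
    the two endpoints. *)
Let P v := Q v + t *: v.
Let D u v := J (Q u) (Q v) + t ^+ 2 * J u v.

Lemma symmetrizedE u v : J (P u) (P v) = D u v + t * b u v.
Proof.
by rewrite /D -QJ !(spdDl J_spd, spdDr J_spd, spdZl J_spd, spdZr J_spd); ring.
Qed.

(** Definiteness comes from the term [t ^+ 2 * J], the other one being nonnegative. *)
Lemma energy_spd : spd_form D.
Proof.
split=> [|x y|x x0].
- split=> z a x y; rewrite /D Q_lin !(spdPl J_spd, spdPr J_spd) /=; ring.
- by rewrite /D !(spdC J_spd y) !(spdC J_spd (Q y)).
- by rewrite ltr_wpDl ?(spd_ge0 J_spd) // mulr_gt0 ?exprn_gt0 ?(spd_gt0 J_spd).
Qed.

Lemma energy_le_symmetrized v : D v v <= J (P v) (P v).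
Proof. by rewrite symmetrizedE lerDl mulr_ge0 // ltW. Qed.

Lemma symmetrizer_linear : linear P.
Proof.
move=> a x y; rewrite /P Q_lin !scalerDr !scalerA [t * a]mulrC.
by rewrite addrACA.
Qed.

Lemma symmetrizer_eq0 v : P v = 0 -> v = 0.
Proof.
move=> Pv0; apply: (spd_eq0 energy_spd); apply: le_anti.
rewrite (spd_ge0 energy_spd) (le_trans (energy_le_symmetrized v)) //.
by rewrite Pv0 (spd0l J_spd).
Qed.

Lemma symmetrized_spd : spd_form (fun u v => J (P u) (P v)).
Proof.
split=> [|x y|x x0].
- by split=> z a x y; rewrite symmetrizer_linear (spdPl J_spd, spdPr J_spd).
- exact: (spdC J_spd).
- exact: lt_le_trans (spd_gt0 energy_spd x0) (energy_le_symmetrized x).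
Qed.

(* [J (Q v - t v) (Q v - t v) >= 0] bounds the boundary term by the energy. *)
Lemma symmetrized_le_energy v : J (P v) (P v) <= 2 * D v v.
Proof.
have := spd_ge0 J_spd (Q v + (- t) *: v).
rewrite symmetrizedE /D -QJ.
rewrite !(spdDl J_spd, spdDr J_spd, spdZl J_spd, spdZr J_spd); nra.
Qed.

Lemma symmetrized_bounded v w :
  `|J (P v) (P w)| <= 2 * Num.sqrt (D v v) * Num.sqrt (D w w).
Proof.
have D0 := spd_ge0 energy_spd.
rewrite -ler_sqr ?nnegrE ?mulr_ge0 ?sqrtr_ge0 // real_normK ?num_real //.
apply: le_trans (spd_CauchySchwarz symmetrized_spd v w) _.
rewrite !exprMn !sqr_sqrtr //.
(* After squaring, the constant [4] is split so that each diagonal value in Cauchy-Schwarz takes one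
   factor [2]. *)
rewrite (_ : _ * _ * _ = (2 * D v v) * (2 * D w w)); last by ring.
by apply: ler_pM; rewrite ?(spd_ge0 J_spd) ?symmetrized_le_energy.
Qed.

End Symmetrization.

(** By rank-nullity, a trivial kernel gives the image full dimension. *)
Lemma linear_inj_surj (K : fieldType) (U : vectType K) (P : U -> U) :
  linear P -> (forall x, P x = 0 -> x = 0) -> forall y, exists x, P x = y.
Proof.
move=> P_lin P_inj y.
pose Pl : {linear U -> U} :=
  HB.pack P (GRing.isLinear.Build K U U *:%R P P_lin).
have kerP : lker (linfun Pl) == 0%VS.
  apply/lker0P => u v; rewrite !lfunE /= => /eqP.
  rewrite -subr_eq0 -(linearB Pl) => /eqP/P_inj/eqP.
  by rewrite subr_eq0 => /eqP.
have limgP : limg (linfun Pl) = fullv.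
  apply/eqP; rewrite eqEdim subvf /= limg_dim_eq //.
  by rewrite (eqP kerP) capv0.
have : y \in limg (linfun Pl) by rewrite limgP memvf.
by case/memv_imgP => x _ ->; exists x; rewrite lfunE.
Qed.

(** * Gram matrices and operators in coordinates *)

Section Coordinates.
Context {R : realType} {V : vectType R} {n : nat} (e : n.-tuple V).
Hypothesis e_basis : basis_of fullv e.
Implicit Types (N : 'M[R]_n) (v w : V).

Lemma coord_col_mx_act N v : coord_col e (mx_act e N v) = N *m coord_col e v.
Proof.
by apply/colP => i; rewrite mxE coord_sum_free ?(basis_free e_basis).
Qed.

Lemma coord_col_linear : linear (coord_col e).
Proof. by move=> a v w; apply/colP => i; rewrite !mxE linearP. Qed.

Lemma mx_act_linear N : linear (mx_act e N).
Proof.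
move=> a v w; rewrite /mx_act coord_col_linear mulmxDr -scalemxAr.
rewrite scaler_sumr -big_split; apply: eq_bigr => i _ /=.
by rewrite !mxE scalerDl scalerA.
Qed.

Lemma gram_mxE (f : V -> V -> R) : spd_form f -> forall v w,
  f v w = ((coord_col e v)^T *m (gram_mx e f *m coord_col e w)) 0 0.
Proof.
move=> f_spd v w.
rewrite {1}(coord_basis e_basis (memvf v)) {1}(coord_basis e_basis (memvf w)).
rewrite (spd_suml_sumr f_spd) mxE; apply: eq_bigr => i _.
rewrite !mxE mulr_sumr; apply: eq_bigr => j _; rewrite !mxE; ring.
Qed.

(** A row in the left kernel is the coordinate row of a vector [v] with [f v v = 0], so it is
    zero. *)
Lemma gram_mx_unit (f : V -> V -> R) : spd_form f -> gram_mx e f \in unitmx.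
Proof.
move=> f_spd; rewrite -row_free_unit; apply: inj_row_free => r rf0.
pose v := \sum_(i < n) r 0 i *: e`_i.
have vr : (coord_col e v)^T = r.
  by apply/rowP => i; rewrite !mxE coord_sum_free ?(basis_free e_basis).
have v0 : v = 0.
  by apply: (spd_eq0 f_spd); rewrite (gram_mxE f_spd) mulmxA vr rf0 mul0mx mxE.
by rewrite -vr v0; apply/rowP => i; rewrite !mxE linear0.
Qed.

Section TwoForms.
Variables f g : V -> V -> R.
Hypotheses (f_spd : spd_form f) (g_spd : spd_form g).
Let M := gram_mx e f.
Let A := gram_mx e g.
Let T := mx_act e (invmx A *m M).

(** With [f] as M-product and [g] as A-product, [T] is [A^-1 M], and the Gram matrix of [g] cancels
    the inverse. *)
Lemma gram_mx_act v w : g (T v) w = f v w.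
Proof.
rewrite (spdC g_spd) (spdC f_spd) (gram_mxE g_spd) (gram_mxE f_spd).
by rewrite coord_col_mx_act -[invmx _ *m _ *m _]mulmxA mulKVmx ?gram_mx_unit.
Qed.

(** In matrices, [M A^-1 M = T^T A T]. *)
Lemma mx_form_gram v w : mx_form e (M *m invmx A *m M) v w = g (T v) (T w).
Proof.
rewrite (spdC g_spd) gram_mx_act (gram_mxE f_spd) coord_col_mx_act.
by rewrite /mx_form !mulmxA.
Qed.

End TwoForms.
End Coordinates.

(** * Integrated forms on V-valued polynomials *)

Section VectorPolynomialForms.
Context {R : realType} {V : vectType R} {p : nat}.
Implicit Types (u v w : vpoly V p) (f : V -> V -> R).

(** Powers of [s] are read as values of polynomials to fit the hypotheses of [int_form_comb]. *)
Lemma vpoly_evalE v s :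
  vpoly_eval v s = \sum_(j < p.+1) ('X^j : {poly R}).[s] *: v j.
Proof. by apply: eq_bigr => j _; rewrite hornerXn. Qed.

Lemma vpoly_eval_tensors q (phi : 'I_p.+1 -> {poly R}) (x : 'I_p.+1 -> V) s :
  (forall j, (size (phi j) <= q.+1)%N) ->
  vpoly_eval (\sum_(j < p.+1) vpoly_tensor q (x j) (phi j)) s
  = \sum_(j < p.+1) (phi j).[s] *: x j.
Proof.
move=> sphi; rewrite /vpoly_eval.
under eq_bigr => i _ do rewrite sum_ffunE scaler_sumr.
rewrite exchange_big /=; apply: eq_bigr => j _.
by rewrite -(vpoly_tensorE (p := q)).
Qed.

Lemma vpoly_eval_deriv v s :
  vpoly_eval (vpoly_deriv v) s
  = \sum_(j < p.+1) ('X^j : {poly R})^`().[s] *: v j.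
Proof.
apply: vpoly_eval_tensors => j; apply: size_deriv_leq.
by rewrite size_polyXn leqW.
Qed.

Lemma vpoly_deriv_reconstructE v :
  vpoly_deriv_reconstruct v
  = \sum_(j < p.+1) vpoly_tensor p (v j) (reconstruct p 'X^j)^`().
Proof.
(* The derivative acts on tensors with the polynomials [reconstruct p 'X^j], which are not
   monomials; basis independence of the action allows it. *)
apply: (@vpoly_act_sum R V p.+1 p p.+1 (@deriv R)) => j.
by apply: size_reconstruct; rewrite size_polyXn.
Qed.

Lemma vpoly_eval_deriv_reconstruct v s :
  vpoly_eval (vpoly_deriv_reconstruct v) s
  = \sum_(j < p.+1) (reconstruct p ('X^j : {poly R}))^`().[s] *: v j.
Proof.
rewrite vpoly_deriv_reconstructE; apply: vpoly_eval_tensors => j.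
by apply/size_deriv_leq/size_reconstruct; rewrite size_polyXn.
Qed.

Lemma vpoly_deriv_reconstruct_linear :
  linear (@vpoly_deriv_reconstruct R V p).
Proof.
move=> a u v; rewrite !vpoly_deriv_reconstructE scaler_sumr -big_split /=.
apply: eq_bigr => j _; apply/ffunP => i.
by rewrite !ffunE scalerDr !scalerA mulrC.
Qed.

Lemma vpoly_map_linear (T : V -> V) : linear T -> linear (@vpoly_map R V p T).
Proof. by move=> T_lin a u v; apply/ffunP => j; rewrite !ffunE T_lin. Qed.

Lemma vpoly_eval_map (T : V -> V) v s : linear T ->
  vpoly_eval (vpoly_map T v) s = T (vpoly_eval v s).
Proof.
move=> T_lin.
pose Tl : {linear V -> V} :=
  HB.pack T (GRing.isLinear.Build R V V *:%R T T_lin).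
rewrite -[T _]/(Tl _) linear_sum /=; apply: eq_bigr => j _.
by rewrite ffunE -[RHS]/(Tl _) linearZ.
Qed.

(** This transfers scalar identities for [poly_int] to [int_form], one pair of indices at a time:
    the integrand is itself a polynomial in [s]. *)
Lemma int_form_comb f (m n : nat) u w
    (a : 'I_m -> {poly R}) (b : 'I_n -> {poly R})
    (x : 'I_m -> V) (y : 'I_n -> V) : spd_form f ->
  (forall s, vpoly_eval u s = \sum_(j < m) (a j).[s] *: x j) ->
  (forall s, vpoly_eval w s = \sum_(k < n) (b k).[s] *: y k) ->
  int_form f u w
  = \sum_(j < m) \sum_(k < n) f (x j) (y k) * poly_int (a j * b k).
Proof.
move=> f_spd uE wE.
transitivity
  (poly_int (\sum_(j < m) \sum_(k < n) f (x j) (y k) *: (a j * b k))).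
  congr Rintegral; apply/funext => s; rewrite uE wE (spd_suml_sumr f_spd).
  rewrite horner_sum; apply: eq_bigr => j _; rewrite horner_sum.
  by apply: eq_bigr => k _; rewrite hornerZ hornerM.
rewrite linear_sum; apply: eq_bigr => j _; rewrite linear_sum.
by apply: eq_bigr => k _; rewrite linearZ.
Qed.

Lemma int_formE f u w : spd_form f ->
  int_form f u w = poly_int (\sum_j \sum_k f (u j) (w k) *: 'X^(j + k)).
Proof.
move=> f_spd; rewrite (int_form_comb f_spd (vpoly_evalE u) (vpoly_evalE w)).
rewrite linear_sum; apply: eq_bigr => j _; rewrite linear_sum.
by apply: eq_bigr => k _; rewrite linearZ exprD.
Qed.

Lemma int_form_spd f : spd_form f -> spd_form (@int_form R V p f).
Proof.
move=> f_spd; have fC := spdC f_spd.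
have C u w : int_form f u w = int_form f w u.
  by congr Rintegral; apply/funext => s.
have lin a (x y z : vpoly V p) :
    int_form f (a *: x + y) z = a * int_form f x z + int_form f y z.
  rewrite !int_formE // -linearP scaler_sumr -big_split; congr poly_int.
  apply: eq_bigr => j _; rewrite scaler_sumr -big_split.
  apply: eq_bigr => k _ /=.
  by rewrite !ffunE (spdPl f_spd) scalerDl scalerA.
split=> [|//|u u0].
  split=> z a x y /=; first exact: lin.
  by rewrite C lin !(C z).
(* [h] is the polynomial [f (u(s)) (u(s))]. It is nonnegative, and if it were zero then [u] would
   vanish at every [s]. *)
set h := \sum_j \sum_k f (u j) (u k) *: 'X^(j + k) : {poly R}.
have hE s : h.[s] = f (vpoly_eval u s) (vpoly_eval u s).
  rewrite !vpoly_evalE (spd_suml_sumr f_spd) horner_sum.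
  apply: eq_bigr => j _; rewrite horner_sum; apply: eq_bigr => k _.
  by rewrite hornerZ exprD hornerM.
rewrite int_formE //; apply: poly_int_gt0 => [s|].
  by rewrite hE (spd_ge0 f_spd).
apply: contra_neq u0 => h0; apply: vpoly_eval_inj => s.
have -> : vpoly_eval u s = 0.
  by apply: (spd_eq0 f_spd); rewrite -hE /h h0 horner0.
by rewrite /vpoly_eval big1 // => j _; rewrite ffunE scaler0.
Qed.

Lemma int_form_deriv_reconstruct f u w : spd_form f ->
  int_form f (vpoly_deriv_reconstruct u) w
  = int_form f (vpoly_deriv u) w + f (vpoly_eval u (-1)) (vpoly_eval w (-1)).
Proof.
move=> f_spd.
rewrite (int_form_comb f_spd (vpoly_eval_deriv_reconstruct u) (vpoly_evalE w)).
rewrite (int_form_comb f_spd (vpoly_eval_deriv u) (vpoly_evalE w)).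
rewrite !vpoly_evalE (spd_suml_sumr f_spd) -big_split; apply: eq_bigr => j _ /=.
rewrite -big_split; apply: eq_bigr => k _ /=.
by rewrite poly_int_deriv_reconstruct ?size_polyXn // mulrDr.
Qed.

Lemma int_form_deriv_reconstruct_sym f u w : spd_form f ->
  int_form f (vpoly_deriv_reconstruct u) w
  + int_form f (vpoly_deriv_reconstruct w) u
  = f (vpoly_eval u 1) (vpoly_eval w 1)
    + f (vpoly_eval u (-1)) (vpoly_eval w (-1)).
Proof.
move=> f_spd.
rewrite (int_form_comb f_spd (vpoly_eval_deriv_reconstruct u) (vpoly_evalE w)).
rewrite (int_form_comb f_spd (vpoly_eval_deriv_reconstruct w) (vpoly_evalE u)).
(* Both double sums now run over the same pairs, so symmetry of [f] lets the scalar identity apply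
   termwise. *)
rewrite [X in _ + X]exchange_big !vpoly_evalE.
rewrite !(spd_suml_sumr f_spd) -!big_split.
apply: eq_bigr => j _ /=; rewrite -!big_split; apply: eq_bigr => k _ /=.
rewrite (spdC f_spd (w k)) -mulrDr.
by rewrite poly_int_deriv_reconstruct_sym ?size_polyXn // mulrDr.
Qed.

End VectorPolynomialForms.

Theorem theorem3p1 (R : realType) (V : vectType R) (n : nat)
    (e : n.-tuple V) (ipM ipA : {dot V for idfun}) (p : nat) (tau : R)
    (F : {scalar (vpoly V p)}) :
  basis_of fullv e ->
  0 < tau ->
  let M : 'M[R]_n := gram_mx e ipM in
  let A : 'M[R]_n := gram_mx e ipA in
  let B : vpoly V p -> vpoly V p -> R := B_form ipM ipA tau in
  let P : vpoly V p -> vpoly V p := P_op e ipM ipA tau in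
  let L : vpoly V p -> vpoly V p -> R := fun u v => B u (P v) in
  let G : vpoly V p -> R := fun v => F (P v) in
  let D : vpoly V p -> vpoly V p -> R := D_form e ipM ipA tau in
  let normD : vpoly V p -> R := fun v => Num.sqrt (D v v) in
  (forall u v : vpoly V p,
     L u v =
       \int[lebesgue_measure]_(s in `[-1, 1]%classic)
         mx_form e (M *m invmx A *m M)
           (vpoly_eval (vpoly_deriv_reconstruct u) s)
           (vpoly_eval (vpoly_deriv_reconstruct v) s)
       + tau ^+ 2 / 4 *
         \int[lebesgue_measure]_(s in `[-1, 1]%classic)
           ipA (vpoly_eval u s) (vpoly_eval v s)
       + tau / 2 * ipM (vpoly_eval u 1) (vpoly_eval v 1)
       + tau / 2 * ipM (vpoly_eval u (-1)) (vpoly_eval v (-1)))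
  /\ spd_form L
  /\ scalar G
  /\ spd_form D
  /\ (forall v : vpoly V p, normD v ^+ 2 <= L v v)
  /\ (forall v w : vpoly V p, `|L v w| <= 2 * normD v * normD w)
  /\ (forall u : vpoly V p,
        (forall v : vpoly V p, B u v = F v) <->
        (forall v : vpoly V p, L u v = G v)).
Proof.
move=> e_basis tau_gt0 M A B P L G D normD.
have M_spd := dot_spd_form ipM; have A_spd := dot_spd_form ipA.
pose T := mx_act e (invmx A *m M).
have T_lin : linear T := mx_act_linear e _.
pose J : vpoly V p -> vpoly V p -> R := int_form ipA.
have J_spd : spd_form J := int_form_spd A_spd.
pose Q (v : vpoly V p) := vpoly_map T (vpoly_deriv_reconstruct v).
have Q_lin : linear Q.
  by move=> a u v; rewrite /Q vpoly_deriv_reconstruct_linear vpoly_map_linear.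
(* The operator [T] converts the A-product into the M-product pointwise under the integral. *)
have JQ u w : J (Q u) w = int_form ipM (vpoly_deriv_reconstruct u) w.
  congr Rintegral; apply/funext => s.
  by rewrite vpoly_eval_map // gram_mx_act.
pose b (u v : vpoly V p) := ipM (vpoly_eval u 1) (vpoly_eval v 1)
  + ipM (vpoly_eval u (-1)) (vpoly_eval v (-1)).
have QJ u v : J (Q u) v + J u (Q v) = b u v.
  by rewrite (spdC J_spd u) !JQ int_form_deriv_reconstruct_sym.
have b_ge0 v : 0 <= b v v by rewrite addr_ge0 ?(spd_ge0 M_spd).
have t_gt0 : 0 < tau / 2 by rewrite divr_gt0.
have t2 : tau ^+ 2 / 4 = (tau / 2) ^+ 2 by field.
have DE : D = fun u v => J (Q u) (Q v) + (tau / 2) ^+ 2 * J u v.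
  apply/funext => u; apply/funext => v; rewrite /D /D_form t2; congr (_ + _).
  congr Rintegral; apply/funext => s.
  by rewrite mx_form_gram // !vpoly_eval_map.
have BE u w : B u w = J (P u) w.
  (* The derivative term and the point term at [-1] merge into [J (Q u) w]; the A-term then joins by
     linearity of [J]. *)
  rewrite /B /B_form -int_form_deriv_reconstruct // -JQ.
  by rewrite -(spdZl J_spd) -(spdDl J_spd).
have LE : L = fun u v => J (P u) (P v).
  by apply/funext => u; apply/funext => v; rewrite /L BE.
have D_spd : spd_form D by rewrite DE; exact: energy_spd.
have P_lin : linear P := symmetrizer_linear _ Q_lin.
have P_surj w : exists v, P v = w.
  exact: (linear_inj_surj P_lin (symmetrizer_eq0 J_spd Q_lin t_gt0 QJ b_ge0)).
split=> [u v|].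
  transitivity (D u v + tau / 2 * b u v); last by rewrite mulrDr addrA.
  by rewrite LE DE; exact: symmetrizedE.
split; first by rewrite LE; exact: (symmetrized_spd J_spd Q_lin t_gt0 QJ).
split; first by move=> a x y; rewrite /G P_lin linearP.
split=> //.
split=> [v|].
  rewrite /normD sqr_sqrtr ?(spd_ge0 D_spd) // DE LE.
  exact: (energy_le_symmetrized J_spd t_gt0 QJ).
split=> [v w|u].
  by rewrite /normD DE LE; exact: (symmetrized_bounded J_spd Q_lin t_gt0 QJ).
(* Forward, the test function is specialized to [P v]; backward, every test function has this
   form. *)
split=> [BF v|LG w]; first exact: BF.
by have [v <-] := P_surj w; exact: LG.
Qed.
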